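(* Let $\mu\in\mathcal M^+(\mathbb R)\setminus\{0\}$ satisfy $\|\mu\|_1\le 1$. Then there exists $c\in I$ satisfying $$c_t(x,t)=H(c,x,t)^2\int_{z\ne x}K'''(c(x,t)-c(z,t))\,d\mu(z),\qquad c(x,0)=x,\qquad (x,t)\in\mathbb R\times(0,\infty).$$
   Context: $\mathbb R^+=[0,\infty)$. $\alpha>0$ is a fixed constant and $K(x)=\frac1{4\alpha^2}(\alpha+|x|)e^{-|x|/\alpha}$; $K'''$ is its classical third derivative, defined on $\mathbb R\setminus\{0\}$. $\mathcal M^+(\mathbb R)$ is the set of finite positive Borel measures on $\mathbb R$ and $\|\cdot\|_1$ is the total variation norm. $I=I_{\mathbb R}$ is the set of locally bounded functions $c:\mathbb R\times\mathbb R^+\to\mathbb R$ such that $c(\cdot,t)$ is Borel measurable for all $t\in\mathbb R^+$, $c(x,\cdot)$ is $C^1$ for all $x\in\mathbb R$, and $c(x,t)<c(y,t)$ for all $t\in\mathbb R^+$ and all $x<y$. $H(c,x,t)=\int_{-\infty}^\infty K(c(x,t)-c(z,t))\,d\mu(z)$. *)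

(* Defs.v *)
From HB Require Import structures.
From mathcomp Require Import all_boot all_order all_algebra.
From mathcomp Require Import all_classical all_reals all_analysis.
Set Implicit Arguments.
Unset Strict Implicit.
Unset Printing Implicit Defensive.
Import Order.TTheory GRing.Theory Num.Theory.
Import numFieldNormedType.Exports.
Local Open Scope classical_set_scope.
Local Open Scope ring_scope.

Definition K (R : realType) (alpha x : R) : R :=
  (4 * alpha ^+ 2)^-1 * (alpha + `|x|) * expR (- `|x| / alpha).

(* K is not three times differentiable at 0, where the value below is
   meaningless; elsewhere it is the classical third derivative. *)
Definition K''' (R : realType) (alpha : R) : R -> R := derive1n 3 (K alpha).

(* A set function takes values on non-measurable sets too: being the zero
   measure is only about measurable sets. *)
Definition zero_measure d (T : measurableType d) (R : realType)
    (nu : set T -> \bar R) : Prop :=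
  forall A, measurable A -> nu A = 0%E.

Definition total_variation_norm d (T : measurableType d) (R : realType)
    (nu : set T -> \bar R) : \bar R :=
  ereal_sup [set v | exists (n : nat) (A : 'I_n -> set T),
    [/\ forall i, measurable (A i), trivIset setT A &
        v = (\sum_(i < n) `|nu (A i)|)%E]].

(* C^1 on the closed half-line: at 0 the derivative is one-sided. *)
Definition C1_nonneg (R : realType) (f : R -> R) : Prop :=
  exists2 f' : R -> R, {within `[0, +oo[, continuous f'} &
    forall t, 0 <= t ->
      (f s - f t) / (s - t) @[s --> within `[0, +oo[ t^'] --> f' t.

(* A function on the product of R and [0, oo) is represented by a function
   c : R -> R -> R whose values c x t with t < 0 are never looked at. *)
Definition in_I (R : realType) (c : R -> R -> R) : Prop :=
  [/\ [locally [bounded c p.1 p.2 | p in [set p : R * R | 0 <= p.2]]],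
      forall t, 0 <= t ->
        measurable_fun setT
          (fun x : measurableTypeR R => c x t : measurableTypeR R),
      forall x, C1_nonneg (c x) &
      forall t x y, 0 <= t -> x < y -> c x t < c y t].

Definition H (R : realType) (alpha : R)
    (mu : {finite_measure set (measurableTypeR R) -> \bar R})
    (c : R -> R -> R) (x t : R) : R :=
  \int[mu]_(z in setT) K alpha (c x t - c z t).

(* Main.v *)
(* The equation is an ordinary differential equation c' = F(c) in the space of
   Borel functions with the sup distance. On increasing c the sign of
   c(x) - c(z) is that of x - z, so K''' may be replaced by a kernel whose jump
   is at z = x instead of at c(z) = c(x); the resulting F is bounded and
   Lipschitz on all Borel functions, and the Euler scheme with steps 2^-n
   converges to a global solution. It remains to see that the solution is
   increasing in x. With g = K''' on (0, oo), the bound |g| <= g(0+) makes the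
   contribution of the z in ]x, y[ to F(c)(y) - F(c)(x) essentially nonnegative,
   whence F(c)(y) - F(c)(x) >= - C |c(y) - c(x)| for every Borel c, increasing or
   not; so an Euler step of length h multiplies c(y) - c(x) by at least 1 - h C. *)
Require Import Defs.
From HB Require Import structures.
From mathcomp Require Import all_boot all_order all_algebra.
From mathcomp Require Import all_classical all_reals all_analysis.
From mathcomp Require Import measurable_realfun ring lra.
Import Order.TTheory GRing.Theory Num.Theory.
Import numFieldNormedType.Exports.
Local Open Scope classical_set_scope.
Local Open Scope ring_scope.

Set Implicit Arguments.
Unset Strict Implicit.

(** * Sequences and inequalities with errors of order [2^-n] *)

Lemma ler_add_halfpow (R : realType) (a b D : R) :
  (forall n, a <= b + D * 2^-1 ^+ n) -> a <= b.
Proof.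
move=> ab; rewrite leNgt; apply/negP => ba.
have ba0 : 0 < a - b by rewrite subr_gt0.
pose n := (Num.truncn (D / (a - b))).+1.
have Dn : D < n%:R * (a - b) by rewrite -ltr_pdivrMr// truncnS_gt.
have n2 : n%:R <= 2 ^+ n :> R by rewrite -natrX ler_nat ltnW// ltn_expl.
have p2 : 0 < 2 ^+ n :> R by rewrite exprn_gt0.
have := ab n; rewrite exprVn -lerBlDl ler_pdivlMr// => h.
by have := ler_wpM2l (ltW ba0) n2; lra.
Qed.

(** The intervals of radius [2 * C * 2^-1 ^+ n] about [v n] are nested, because the radius drops by
    [C * 2^-1 ^+ n] at each step; the limit is the supremum of their left ends. *)
Lemma halfpow_cauchy (R : realType) (v : nat -> R) (C : R) :
  (forall n, `|v n.+1 - v n| <= C * 2^-1 ^+ n) ->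
  exists l : R, forall n, `|v n - l| <= 2 * C * 2^-1 ^+ n.
Proof.
move=> dv.
have C0 : 0 <= C by have := le_trans (normr_ge0 _) (dv 0%N); rewrite expr0 mulr1.
pose w n := v n - 2 * C * 2^-1 ^+ n.
pose W n := v n + 2 * C * 2^-1 ^+ n.
have p n : 0 <= C * 2^-1 ^+ n by rewrite mulr_ge0// exprn_ge0.
have ndw : nondecreasing_seq w.
  apply/nondecreasing_seqP => n; have := dv n; rewrite /w exprS ler_norml.
  by move=> /andP[h1 h2]; lra.
have niW : nonincreasing_seq W.
  apply/nonincreasing_seqP => n; have := dv n; rewrite /W exprS ler_norml.
  by move=> /andP[h1 h2]; lra.
have wW n m : w n <= W m.
  apply: (@le_trans _ _ (w (maxn n m))); first by apply: ndw; exact: leq_maxl.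
  apply: (@le_trans _ _ (W (maxn n m))); last by apply: niW; exact: leq_maxr.
  by rewrite /w /W; have := p (maxn n m); lra.
have wb : has_ubound (range w) by exists (W 0%N) => _ [n _ <-].
exists (sup (range w)) => n; rewrite ler_norml; apply/andP; split.
  have : sup (range w) <= W n.
    by apply: ge_sup => [|_ [m _ <-]//]; exists (w 0%N), 0%N.
  by rewrite /W; lra.
have : w n <= sup (range w) by apply: ub_le_sup => //; exists n.
by rewrite /w; lra.
Qed.

(** * Convergence of the Euler scheme for a bounded Lipschitz field *)

Section euler.
Context {R : realType} {T : Type}.
(** [P] will be Borel measurability: [F] is controlled only on a class preserved by Euler steps and
    pointwise limits. *)
Variables (F : (T -> R) -> T -> R) (P : set (T -> R)) (c0 : T -> R) (M L : R).
Hypothesis Pc0 : P c0.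
Hypothesis P_step : forall h c, P c -> P (fun x => c x + h * F c x).
Hypothesis P_lim : forall (u : nat -> T -> R) c,
  (forall n, P (u n)) -> (forall x, u ^~ x @ \oo --> c x) -> P c.
Hypothesis F_bound : forall c x, P c -> `|F c x| <= M.
Hypothesis F_lip : forall c d (e : R), P c -> P d ->
  (forall x, `|c x - d x| <= e) -> forall x, `|F c x - F d x| <= L * e.
Hypotheses (M0 : 0 <= M) (L0 : 0 <= L).

Definition euler h k := iter k (fun c x => c x + h * F c x) c0.

Lemma euler_S h k x :
  euler h k.+1 x = euler h k x + h * F (euler h k) x.
Proof. by []. Qed.

Lemma euler_in h k : P (euler h k).
Proof. by elim: k => //= k; exact: P_step. Qed.

Lemma euler_growth h j k x : 0 <= h ->
  `|euler h (j + k) x - euler h j x| <= M * (h * k%:R).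
Proof.
move=> h0; elim: k => [|k IH]; first by rewrite addn0 subrr normr0 !mulr0.
rewrite addnS euler_S addrAC (le_trans (ler_normD _ _))//.
have := F_bound x (euler_in h (j + k)).
rewrite normrM (ger0_norm h0) => /(ler_wpM2l h0); rewrite -(natr1 k); lra.
Qed.

(** Each of the [k] steps uses a slope that differs from the initial one by at most [L] times the
    distance travelled. The bound depends on [h * k] only, so it survives in the limit. *)
Lemma euler_consistent h j k x : 0 <= h ->
  `|euler h (j + k) x - euler h j x - h * k%:R * F (euler h j) x|
    <= L * M * (h * k%:R) ^+ 2.
Proof.
move=> h0; elim: k => [|k IH].
  by rewrite addn0 subrr mulr0 mul0r subrr normr0 expr2 !mulr0.
rewrite addnS euler_S -(natr1 k).
set a := euler h (j + k) x; set b := euler h j x; set f := F _ x; set g := F _ x.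
have -> : a + h * f - b - h * (k%:R + 1) * g = (a - b - h * k%:R * g) + h * (f - g).
  by ring.
apply: le_trans (ler_normD _ _) _.
have fg : `|f - g| <= L * (M * (h * k%:R)).
  by apply: F_lip; [exact: euler_in..|move=> y; exact: euler_growth].
have : `|h * (f - g)| <= h * (L * (M * (h * k%:R))).
  by rewrite normrM (ger0_norm h0) ler_wpM2l.
have k0 : 0 <= k%:R :> R by [].
have : 0 <= L * M * h ^+ 2 * (k%:R + 1) by rewrite !mulr_ge0// ?exprn_ge0// addr_ge0.
move: IH; rewrite -/a -/b -/g; nra.
Qed.

(** Discrete Gronwall: one coarse step against two fine ones creates an error [h ^+ 2 * L * M] and
    multiplies the previous error by at most [1 + 2 * h * L <= expR (2 * h * L)]. *)
Lemma euler_refine h k x : 0 <= h ->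
  `|euler h (2 * k) x - euler (2 * h) k x|
    <= h ^+ 2 * L * M * k%:R * expR (2 * h * L * k%:R).
Proof.
move=> h0; elim: k x => [|k IH] x.
  by rewrite muln0 subrr normr0 mulr0 mul0r.
have -> : (2 * k.+1 = (2 * k).+2)%N by rewrite mulnS.
rewrite !euler_S; set u := euler h (2 * k) in IH *; set v := euler (2 * h) k in IH *.
set u' := euler h (2 * k).+1.
have Pu : P u by exact: euler_in.
have Pv : P v by exact: euler_in.
have Pu' : P u' by exact: euler_in.
set e := h ^+ 2 * L * M * k%:R * _ in IH.
have uv : `|F u x - F v x| <= L * e by exact: F_lip.
have uu' : `|F u' x - F u x| <= L * (M * h).
  apply: F_lip => // y; rewrite /u' euler_S -/u addrC addKr normrM (ger0_norm h0).
  by rewrite mulrC ler_wpM2r// F_bound.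
(* The old error, its effect on the slopes, and the drift of the slope between the two fine
   steps. *)
have -> : u x + h * F u x + h * F u' x - (v x + 2 * h * F v x) =
  (u x - v x) + 2 * h * (F u x - F v x) + h * (F u' x - F u x) by ring.
have {IH uu' uv} step : `|u x - v x + 2 * h * (F u x - F v x) + h * (F u' x - F u x)| <=
    e * (1 + 2 * h * L) + h ^+ 2 * L * M.
  apply: le_trans (ler_normD _ _) _.
  have := ler_normD (u x - v x) (2 * h * (F u x - F v x)).
  rewrite !normrM (ger0_norm h0) (@ger0_norm _ 2)//.
  have := ler_wpM2l h0 uu'; have := ler_wpM2l h0 uv; have := IH x; lra.
apply: le_trans step _.
have Q0 : 0 <= h ^+ 2 * L * M by rewrite !mulr_ge0// exprn_ge0.
have hL0 : 0 <= 2 * h * L by rewrite !mulr_ge0.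
rewrite -(natr1 k) (mulrDr (2 * h * L)) mulr1 expRD.
set E := expR (2 * h * L * k%:R) in e *; set E1 := expR (2 * h * L).
have E1ge : 1 + 2 * h * L <= E1 by exact: expR_ge1Dx.
have Ege : 1 <= E by apply: le_trans (expR_ge1Dx _); rewrite lerDl mulr_ge0.
have e0 : 0 <= e by rewrite !mulr_ge0// ?exprn_ge0// expR_ge0.
have EE : 1 <= E * E1 by rewrite -[1]mulr1 ler_pM// (le_trans _ E1ge)// lerDl.
have := ler_wpM2l e0 E1ge; have := ler_wpM2l Q0 EE.
rewrite /e; lra.
Qed.

Definition dyadic n (t : R) := Num.truncn (t * 2 ^+ n).

Definition euler_approx n t := euler (2^-1 ^+ n) (dyadic n t).

Lemma dyadic_itv n t : 0 <= t ->
  2^-1 ^+ n * (dyadic n t)%:R <= t < 2^-1 ^+ n * (dyadic n t)%:R + 2^-1 ^+ n.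
Proof.
move=> t0; have p : 0 < 2 ^+ n :> R by rewrite exprn_gt0.
have := @truncn_itv _ (t * 2 ^+ n) (mulr_ge0 t0 (ltW p)).
rewrite exprVn -/(dyadic n t) -natr1 -ler_pdivrMr// -ltr_pdivlMr//.
by move=> /andP[h1 h2]; apply/andP; split; lra.
Qed.

(** [dyadic n.+1 t] is twice [dyadic n t] or one more, so the error is that of [euler_refine] plus
    at most one fine step. *)
Lemma euler_approx_step n t x : 0 <= t ->
  `|euler_approx n.+1 t x - euler_approx n t x|
    <= (L * M * t * expR (2 * L * t) + M) * 2^-1 ^+ n.
Proof.
move=> t0; rewrite /euler_approx.
have := dyadic_itv n.+1 t0; have := dyadic_itv n t0.
set h := 2^-1 ^+ n.+1; have -> : 2^-1 ^+ n = 2 * h :> R.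
  by rewrite /h exprS mulrA mulfV// mul1r.
have h0 : 0 < h by rewrite exprn_gt0.
set k := dyadic n t; set k' := dyadic n.+1 t.
move=> /andP[k1 k2] /andP[k1' k2'].
have kk' : (2 * k <= k')%N.
  rewrite -ltnS -(ltr_nat R) -(ltr_pM2l h0) natrM -(natr1 k'); lra.
have k'k : (k' - 2 * k <= 1)%N.
  rewrite leq_subLR addn1 -ltnS -(ltr_nat R) -(ltr_pM2l h0) -(natr1 (2 * k).+1) -(natr1 (2 * k)) natrM; lra.
have tri := ler_distD (euler h (2 * k) x) (euler h k' x) (euler (2 * h) k x).
apply: le_trans tri _; rewrite (mulrDl (_ * _ * _ * _)) addrC.
apply: lerD.
- apply: le_trans (euler_refine k x (ltW h0)) _.
  have : expR (2 * h * L * k%:R) <= expR (2 * L * t).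
    rewrite ler_expR; have := ler_wpM2l L0 k1; have := mulr_ge0 L0 t0; lra.
  have LMh : 0 <= L * M * h by rewrite !mulr_ge0// ltW.
  have := expR_ge0 (2 * h * L * k%:R).
  have hk : 0 <= h * k%:R by rewrite mulr_ge0// ltW.
  set E := expR _; set E' := expR _ => E0 EE'.
  have hkt : h * k%:R <= t by lra.
  have := ler_pM hk E0 hkt EE'.
  have tE : 0 <= t * E' by rewrite mulr_ge0// expR_ge0.
  move=> /(ler_wpM2l LMh); have := mulr_ge0 LMh tE; lra.
- have := euler_growth (2 * k) (k' - 2 * k) x (ltW h0).
  rewrite subnKC// => /le_trans; apply; rewrite ler_wpM2l//.
  have : (k' - 2 * k)%:R <= 1 :> R by rewrite (ler_nat R _ 1).
  by move/(ler_wpM2l (ltW h0)); lra.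
Qed.

(** The bound depends on the elapsed time [h * k] only, so the gap stays away from 0 as the mesh
    shrinks. It also keeps the gap nonnegative, which removes the absolute value at the next
    step. *)
Lemma euler_order h k (C : R) x y : 0 <= h -> 0 <= C -> 2 * (h * C) <= 1 ->
  (forall c, P c -> - (C * `|c y - c x|) <= F c y - F c x) -> c0 x <= c0 y ->
  expR (- (2 * C * (h * k%:R))) * (c0 y - c0 x) <= euler h k y - euler h k x.
Proof.
move=> h0 C0 hC F_order xy; elim: k => [|k IH].
  by rewrite !mulr0 oppr0 expR0 mul1r.
rewrite !euler_S -(natr1 k).
rewrite (_ : - (2 * C * (h * (k%:R + 1))) = - (2 * C * (h * k%:R)) + - (2 * C * h));
  last by ring.
rewrite expRD.
have := F_order _ (euler_in h k).
set a := euler h k x in IH *; set b := euler h k y in IH *.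
set E := expR _ in IH *; set E1 := expR _; set u := F _ _; set v := F _ _.
have Ed0 : 0 <= E * (c0 y - c0 x) by rewrite mulr_ge0 ?expR_ge0// subr_ge0.
have ba0 : 0 <= b - a by lra.
(* With [s = h * C], at most 1/2, one has [(1 - s) * (1 + 2 * s) >= 1] and
   [1 + 2 * s <= expR (2 * s)]. *)
have E1le : E1 <= 1 - h * C.
  have hC0 : 0 <= h * C by rewrite mulr_ge0.
  have E1p : 0 < expR (2 * (h * C)) by exact: expR_gt0.
  rewrite /E1 (_ : 2 * C * h = 2 * (h * C)); last by ring.
  rewrite expRN -[_^-1]mul1r ler_pdivrMr//.
  have := expR_ge1Dx (2 * (h * C)) => /(@ler_wpM2l _ (1 - h * C)).
  by move=> /(_ ltac:(lra)); nra.
rewrite ger0_norm// => /(ler_wpM2l h0).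
have := expR_ge0 (- (2 * C * h)); rewrite -/E1.
have := ler_wpM2r ba0 E1le; have := ler_wpM2l (expR_ge0 (- (2 * C * h))) IH.
rewrite -/E1; lra.
Qed.

(** The flow is described by a Taylor estimate rather than by a derivative, because an inequality
    passes to the limit. *)
Lemma euler_flow : exists c : T -> R -> R,
  [/\ forall x, c x 0 = c0 x,
      forall t, 0 <= t -> P (c ^~ t),
      forall x s t, 0 <= s <= t -> `|c x t - c x s| <= M * (t - s),
      forall x s t, 0 <= s <= t ->
        `|c x t - c x s - (t - s) * F (c ^~ s) x| <= L * M * (t - s) ^+ 2 &
      forall x y C, 0 <= C ->
        (forall d, P d -> - (C * `|d y - d x|) <= F d y - F d x) ->
        c0 x < c0 y -> forall t, 0 <= t -> c x t < c y t].
Proof.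
have [c cP] : {c : T -> R -> R & forall x t, 0 <= t -> forall n,
    `|euler_approx n t x - c x t| <=
      2 * (L * M * t * expR (2 * L * t) + M) * 2^-1 ^+ n}.
  have /choice[c cP] : forall xt : T * R, exists l : R, 0 <= xt.2 -> forall n,
    `|euler_approx n xt.2 xt.1 - l| <=
      2 * (L * M * xt.2 * expR (2 * L * xt.2) + M) * 2^-1 ^+ n.
    move=> [x t] /=; have [t0|t0] := leP 0 t; last by exists 0.
    have [l lP] := halfpow_cauchy (v := fun n => euler_approx n t x)
       (fun n => euler_approx_step n x t0).
    by exists l.
  by exists (fun x t => c (x, t)) => x t; exact: (cP (x, t)).
have hpos n : 0 < 2^-1 ^+ n :> R by rewrite exprn_gt0.
have hle1 n : 2^-1 ^+ n <= 1 :> R by rewrite exprn_ile1// ?invr_ge0// invf_le1// ler1n.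
have appD t : 0 <= t -> exists2 D, 0 <= D & forall n x,
    `|euler_approx n t x - c x t| <= D * 2^-1 ^+ n.
  move=> t0; exists (2 * (L * M * t * expR (2 * L * t) + M)) => [|n x]; last exact: cP.
  by rewrite mulr_ge0// addr_ge0// !mulr_ge0// expR_ge0.
have Pc t : 0 <= t -> P (c ^~ t).
  move=> t0; apply: (P_lim (u := fun n => euler_approx n t)) => [n|x].
    exact: euler_in.
  have [D D0 cD] := appD t t0; apply/cvgrPdist_le => e e0.
  have : D *: (2^-1 ^+ n : R) @[n --> \oo] --> D *: (0 : R).
    apply: cvgZr; apply: cvg_expr; rewrite ger0_norm ?invr_ge0//.
    by rewrite invf_lt1// ltr1n.
  rewrite scaler0 => /cvgrPdist_le /(_ e e0); apply: filterS => n /=.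
  rewrite sub0r normrN distrC; apply: le_trans; apply: le_trans (cD n x) _.
  exact: ler_norm.
have dy s t n : 0 <= s <= t -> (dyadic n s <= dyadic n t)%N.
  by move=> /andP[s0 st]; rewrite le_truncn// ler_wpM2r// exprn_ge0.
exists c; split=> //.
- move=> x; apply/eqP; rewrite -subr_eq0 -normr_le0.
  have [D D0 cD] := appD 0 (lexx _).
  apply: (ler_add_halfpow (D := D)) => n; rewrite add0r distrC.
  by have := cD n x; rewrite /euler_approx /dyadic mul0r truncn0.
- move=> x s t st; have /andP[s0 st'] := st; have t0 := le_trans s0 st'.
  have [Dt Dt0 cDt] := appD t t0; have [Ds Ds0 cDs] := appD s s0.
  apply: (ler_add_halfpow (D := Ds + Dt + M)) => n.
  have := cDt n x; have := cDs n x; rewrite /euler_approx.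
  have := dyadic_itv n t0; have := dyadic_itv n s0.
  have := euler_growth (dyadic n s) (dyadic n t - dyadic n s) x (ltW (hpos n)).
  rewrite subnKC ?dy// natrB ?dy//.
  set h := 2^-1 ^+ n; set k := (dyadic n t)%:R; set j := (dyadic n s)%:R.
  move=> + /andP[j1 j2] /andP[k1 k2].
  have : M * (h * (k - j)) <= M * (t - s + h) by rewrite ler_wpM2l//; lra.
  move=> h1 h2; have {h1 h2} := le_trans h2 h1.
  rewrite !ler_norml => /andP[? ?] /andP[? ?] /andP[? ?].
  by apply/andP; split; lra.
- move=> x s t st; have /andP[s0 st'] := st; have t0 := le_trans s0 st'.
  have [Dt Dt0 cDt] := appD t t0; have [Ds Ds0 cDs] := appD s s0.
  (* The terms of [D] pay, in order, for the two end values, for replacing the Euler state by its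
     limit inside [F], and for rounding to the grid in the linear and quadratic terms. *)
  apply: (ler_add_halfpow
    (D := Ds + Dt + (t - s) * (L * Ds) + M + L * M * (2 * (t - s) + 1))) => n.
  have Fdist : `|F (euler_approx n s) x - F (c ^~ s) x| <= L * (Ds * 2^-1 ^+ n).
    by apply: F_lip; [exact: euler_in|exact: Pc|exact: cDs].
  have Fb := F_bound x (euler_in (2^-1 ^+ n) (dyadic n s)).
  have := cDt n x; have := cDs n x; move: Fdist; rewrite /euler_approx.
  have := dyadic_itv n t0; have := dyadic_itv n s0.
  have := euler_consistent (dyadic n s) (dyadic n t - dyadic n s) x (ltW (hpos n)).
  rewrite subnKC ?dy// natrB ?dy//; move: Fb (hpos n) (hle1 n).
  have kj : (dyadic n s)%:R <= (dyadic n t)%:R :> R by rewrite ler_nat dy.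
  move: kj.
  set h := 2^-1 ^+ n; set k := (dyadic n t)%:R; set j := (dyadic n s)%:R.
  set a := euler h _ x; set b := euler h _ x; set f := F _ x; set g := F _ x.
  move=> jk fM h0 h1 con /andP[j1 j2] /andP[k1 k2] fg ds dt.
  have d0 : 0 <= h * (k - j) by rewrite mulr_ge0 ?subr_ge0// ltW.
  have sq : (h * (k - j)) ^+ 2 <= (t - s) ^+ 2 + (2 * (t - s) + 1) * h.
    have : (h * (k - j)) ^+ 2 <= (t - s + h) ^+ 2 by rewrite lerXn2r// ?nnegrE//; lra.
    move/le_trans; apply.
    have : h ^+ 2 <= h by rewrite expr2 ler_piMl// ltW.
    by rewrite sqrrD; lra.
  have LM0 : 0 <= L * M by rewrite mulr_ge0.
  have {}con := le_trans con (ler_wpM2l LM0 sq).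
  have -> : c x t - c x s - (t - s) * g =
    (c x t - a) + (b - c x s) + ((t - s) * (f - g) + (h * (k - j) - (t - s)) * f)
      + (a - b - h * (k - j) * f) by ring.
  apply: le_trans (ler_normD _ _) _.
  have := ler_normD (c x t - a + (b - c x s))
     ((t - s) * (f - g) + (h * (k - j) - (t - s)) * f).
  have := ler_normD (c x t - a) (b - c x s).
  have := ler_normD ((t - s) * (f - g)) ((h * (k - j) - (t - s)) * f).
  rewrite !normrM (distrC (c x t)).
  have ts0 : 0 <= t - s by lra.
  have hkj : `|h * (k - j) - (t - s)| <= h by rewrite ler_norml; apply/andP; split; lra.
  rewrite (ger0_norm ts0).
  have := ler_wpM2l ts0 fg.
  have := ler_pM (normr_ge0 _) (normr_ge0 _) hkj fM.
  lra.
- move=> x y C C0 F_order xy t t0; have [D D0 cD] := appD t t0.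
  (* From level [N] on, the steps are short enough for [euler_order]; hence the level [n + N]
     below. *)
  pose N := (Num.truncn (2 * C)).+1.
  have CN : 2 * (2^-1 ^+ N * C) <= 1.
    have N2 : N%:R <= 2 ^+ N :> R by rewrite -natrX ler_nat ltnW// ltn_expl.
    have : 2 * C <= 2 ^+ N by rewrite (le_trans _ N2)// ltW// truncnS_gt.
    by rewrite mulrCA exprVn ler_pdivrMl ?mulr1// exprn_gt0.
  (* The positive lower bound [E] does not depend on [n], so the inequality stays strict in the
     limit. *)
  rewrite -subr_gt0; set E := expR (- (2 * C * t)) * (c0 y - c0 x).
  have E0 : 0 < E by rewrite mulr_gt0 ?expR_gt0// subr_gt0.
  apply: (lt_le_trans E0); apply: (ler_add_halfpow (D := 2 * D)) => n.
  have nN : 2^-1 ^+ (n + N) <= 2^-1 ^+ N :> R.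
    by rewrite exprD ler_piMl// ltW.
  have nn : 2^-1 ^+ (n + N) <= 2^-1 ^+ n :> R by rewrite exprD ler_piMr// ltW.
  have := cD (n + N)%N x; have := cD (n + N)%N y; rewrite /euler_approx.
  have := dyadic_itv (n + N) t0; move: (hpos (n + N)%N) nN nn.
  set h := 2^-1 ^+ (n + N); set k := dyadic _ _ => h0 nN nn /andP[k1 _].
  have hC : 2 * (h * C) <= 1 by have := ler_wpM2r C0 nN; lra.
  have := euler_order k (ltW h0) C0 hC F_order (ltW xy).
  have : E <= expR (- (2 * C * (h * k%:R))) * (c0 y - c0 x).
    rewrite /E ler_wpM2r ?subr_ge0 ?(ltW xy)// ler_expR lerN2 ler_wpM2l//.
    by rewrite mulr_ge0.
  have := ler_wpM2l D0 nn.
  move=> h1 h2 h3; rewrite !ler_norml => /andP[? ?] /andP[? ?]; lra.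
Qed.

End euler.

(** * Affine functions times an exponential *)

Section affine_exp.
Context {R : realType}.
Implicit Types a b alpha r s x : R.

(** On each open half-line [K] and its derivatives have this form, with [- alpha] for [alpha] on the
    negative one. *)
Definition affine_exp alpha a b r := (a + b * r) * expR (- r / alpha).

Lemma is_derive_affine_exp alpha a b x :
  is_derive x 1 (affine_exp alpha a b)
    (affine_exp alpha (b - a / alpha) (- (b / alpha)) x).
Proof.
rewrite /affine_exp.
have e : is_derive x 1 (fun r => expR (- r / alpha))
    (- alpha^-1 * expR (- x / alpha)).
  have -> : (fun r => expR (- r / alpha)) = expR \o (fun r => - alpha^-1 * r).
    by apply/funext => r /=; congr expR; rewrite mulrC mulrN mulNr.
  apply: is_derive_eq => /=.
  by rewrite /GRing.scale/= mulr1 mulrC; congr (_ * expR _); rewrite mulrC mulrN mulNr.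
apply: is_derive_eq.
by rewrite /GRing.scale/=; ring.
Qed.

Lemma affine_exp_bound alpha a b r : 0 < alpha -> 0 <= r ->
  `|affine_exp alpha a b r| <= `|a| + `|b| * alpha.
Proof.
move=> al0 r0; rewrite /affine_exp normrM (ger0_norm (expR_ge0 _)).
rewrite mulNr expRN ler_pdivrMr ?expR_gt0//.
have ra0 : 0 <= r / alpha by rewrite divr_ge0// ltW.
have := expR_ge1Dx (r / alpha); set E := expR _ => E1.
have rE : r <= alpha * E.
  have := ler_wpM2l (ltW al0) E1.
  by rewrite mulrDr mulrCA divff ?gt_eqF//; lra.
apply: le_trans (ler_normD _ _) _; rewrite normrM (ger0_norm r0) mulrDl.
rewrite lerD//; first by rewrite ler_peMr//; lra.
by rewrite -mulrA ler_wpM2l.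
Qed.

(** The derivative is again an [affine_exp], so [affine_exp_bound] controls it and the mean value
    theorem applies. *)
Lemma affine_exp_lipschitz alpha a b : 0 < alpha ->
  exists2 L, 0 <= L & forall r s, 0 <= r -> 0 <= s ->
    `|affine_exp alpha a b r - affine_exp alpha a b s| <= L * `|r - s|.
Proof.
move=> al0; exists (`|b - a / alpha| + `|- (b / alpha)| * alpha).
  by rewrite addr_ge0// mulr_ge0// ltW.
move=> r s; wlog sr : r s / s <= r => [wl|] r0 s0.
  have [/wl|/ltW/wl] := leP s r; first exact.
  by rewrite distrC (distrC r); exact.
have [c] := @MVT_segment _ (affine_exp alpha a b) _ s r sr
  (fun x _ => is_derive_affine_exp alpha a b x)
  ltac:(by apply: derivable_within_continuous => x _;
        have [] := is_derive_affine_exp alpha a b x).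
rewrite in_itv/= => /andP[sc cr] ->.
by rewrite normrM ler_wpM2r// affine_exp_bound// (le_trans s0).
Qed.

(** The conclusion has the form of the hypothesis, so it can be iterated up to the third derivative;
    [U] will be an open half-line. *)
Lemma derive1_affine_exp (U : set R) (f : R -> R) alpha a b : open U ->
  (forall x, U x -> f x = affine_exp alpha a b x) ->
  forall x, U x -> derive1 f x =
    affine_exp alpha (b - a / alpha) (- (b / alpha)) x.
Proof.
move=> oU fE x Ux; rewrite derive1E.
rewrite (near_eq_derive (g := affine_exp alpha a b)).
  by have [_ ->] := is_derive_affine_exp alpha a b x.
by apply: filterS (open_nbhs_nbhs (conj oU Ux)) => y; exact: fE.
Qed.

End affine_exp.

(** * The kernel and its third derivative *)

Section kernel.
Context {R : realType}.
Variable alpha : R.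
Hypothesis alpha0 : 0 < alpha.

(** This is [(2 * alpha - r) * expR (- r / alpha) / (4 * alpha ^+ 5)]; its value at 0 is the right
    limit of [K''']. *)
Definition K3 (r : R) := affine_exp alpha (2 / (4 * alpha ^+ 4)) (- ((4 * alpha ^+ 5)^-1)) r.

Lemma K'''_gt0 x : 0 < x -> K''' alpha x = K3 x.
Proof.
move=> x0; rewrite /K''' /derive1n /=.
have K0 y : `]0, +oo[%classic y ->
    K alpha y = affine_exp alpha (4 * alpha)^-1 (4 * alpha ^+ 2)^-1 y.
  rewrite /= in_itv/= andbT => y0; rewrite /K /affine_exp (gtr0_norm y0).
  by congr (_ * _); field; rewrite gt_eqF.
have oU : open (`]0, +oo[%classic : set R) by exact: interval_open.
have K1 := derive1_affine_exp oU K0.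
have K2 := derive1_affine_exp oU K1.
rewrite (derive1_affine_exp oU K2) /=; last by rewrite in_itv/= x0.
by rewrite /K3 /affine_exp; congr ((_ + _ * _) * _); field; rewrite gt_eqF.
Qed.

Lemma K'''_lt0 x : x < 0 -> K''' alpha x = - K3 (- x).
Proof.
move=> x0; rewrite /K''' /derive1n /=.
have K0 y : `]-oo, 0[%classic y ->
    K alpha y = affine_exp (- alpha) (4 * alpha)^-1 (- (4 * alpha ^+ 2)^-1) y.
  rewrite /= in_itv/= => y0; rewrite /K /affine_exp (ltr0_norm y0).
  congr (_ * expR _); first by field; rewrite gt_eqF.
  by rewrite invrN mulrN mulNr.
have oU : open (`]-oo, 0[%classic : set R) by exact: interval_open.
have K1 := derive1_affine_exp oU K0.
have K2 := derive1_affine_exp oU K1.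
rewrite (derive1_affine_exp oU K2) /=; last by rewrite in_itv/= x0.
rewrite /K3 /affine_exp -[RHS]mulNr; congr (_ * expR _).
  by field; rewrite gt_eqF.
by rewrite invrN mulrN !mulNr.
Qed.

(** With [s = r / alpha] this reduces to [|2 - s| <= 2 * expR s], which follows from
    [1 + s <= expR s]. *)
Lemma K3_norm_le r : 0 <= r -> `|K3 r| <= K3 0.
Proof.
move=> r0; rewrite /K3 /affine_exp mulr0 addr0 oppr0 mul0r expR0 mulr1.
have -> : 2 / (4 * alpha ^+ 4) + - (4 * alpha ^+ 5)^-1 * r =
   (4 * alpha ^+ 4)^-1 * (2 - r / alpha) by field; rewrite gt_eqF.
have p : 0 < (4 * alpha ^+ 4)^-1 by rewrite invr_gt0 mulr_gt0// exprn_gt0.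
rewrite normrM normrM (gtr0_norm p) (ger0_norm (expR_ge0 _)) [2 * _]mulrC -mulrA.
rewrite ler_pM2l// mulNr expRN ler_pdivrMr ?expR_gt0//.
have ra0 : 0 <= r / alpha by rewrite divr_ge0// ltW.
have := expR_ge1Dx (r / alpha) => E1.
by rewrite ler_norml; apply/andP; split; lra.
Qed.

Lemma K_affine_exp x :
  K alpha x = affine_exp alpha (4 * alpha)^-1 (4 * alpha ^+ 2)^-1 `|x|.
Proof. by rewrite /K /affine_exp; congr (_ * _); field; rewrite gt_eqF. Qed.

Lemma K_lipschitz : exists2 L, 0 <= L & forall x y,
  `|K alpha x - K alpha y| <= L * `|x - y|.
Proof.
have [L L0 KL] :=
  affine_exp_lipschitz (4 * alpha)^-1 (4 * alpha ^+ 2)^-1 alpha0.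
exists L => // x y; rewrite !K_affine_exp (le_trans (KL _ _ _ _))//.
by rewrite ler_wpM2l// ler_dist_dist.
Qed.

Lemma K_bound : exists2 B, 0 <= B & forall x, `|K alpha x| <= B.
Proof.
eexists; last by move=> x; rewrite K_affine_exp; exact: affine_exp_bound.
by rewrite addr_ge0// mulr_ge0// ltW.
Qed.

(* Agrees with K''' w when w has the sign of x - z; off that range the value is
   frozen at K'''(0+) or K'''(0-), which keeps it Lipschitz in w. *)
Definition ordered_K3 (x z w : R) :=
  if z < x then K3 (Num.max w 0)
  else if x < z then - K3 (Num.max (- w) 0) else 0.

Lemma ordered_K3_bound x z w : `|ordered_K3 x z w| <= K3 0.
Proof.
have m0 (v : R) : 0 <= Num.max v 0 by rewrite le_max lexx orbT.
have K30 := le_trans (normr_ge0 _) (K3_norm_le (lexx 0)).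
rewrite /ordered_K3; case: ifP => _; first by rewrite K3_norm_le.
by case: ifP => _; rewrite ?normr0// normrN K3_norm_le.
Qed.

(** The last clause is the order estimate for a single [z]. Outside [[x, y]] both terms come from
    the same branch and differ by a Lipschitz error; strictly inside, the difference is a sum of two
    values of [K3], and at an endpoint only one of them remains. *)
Lemma ordered_K3_lipschitz : exists L, [/\ 0 <= L,
  forall x z w v, `|ordered_K3 x z w - ordered_K3 x z v| <= L * `|w - v| &
  forall (c : R -> R) x y z, x < y -> - (L * `|c y - c x|) <=
    ordered_K3 y z (c y - c z) - ordered_K3 x z (c x - c z)].
Proof.
have [L L0 K3L] := affine_exp_lipschitz
  (2 / (4 * alpha ^+ 4)) (- (4 * alpha ^+ 5)^-1) alpha0; exists L.
have m0 (v : R) : 0 <= Num.max v 0 by rewrite le_max lexx orbT.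
have mL (w v : R) : `|Num.max w 0 - Num.max v 0| <= `|w - v|.
  have := ler_norm (w - v); have := ler_norm (v - w); rewrite (distrC v).
  by case: (leP w 0); case: (leP v 0) => ? ?; rewrite ler_norml => ? ?;
    apply/andP; split; lra.
have KL w v : `|K3 (Num.max w 0) - K3 (Num.max v 0)| <= L * `|w - v|.
  by rewrite (le_trans (K3L _ _ (m0 _) (m0 _)))// ler_wpM2l.
have K30 := le_trans (normr_ge0 _) (K3_norm_le (lexx 0)).
split=> //.
  move=> x z w v; rewrite /ordered_K3; case: ifP => // _; case: ifP => _.
    by rewrite -opprD normrN (le_trans (KL _ _))// -opprD normrN.
  by rewrite subrr normr0 mulr_ge0.
have Klb (v : R) : - (L * `|v|) <= K3 (Num.max v 0).
  have := KL v 0; rewrite maxxx subr0 ler_norml => /andP[]; lra.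
move=> c x y z xy; rewrite /ordered_K3.
have [zx|xz|->] := ltgtP z x.
- rewrite (lt_trans zx xy); have := KL (c y - c z) (c x - c z).
  by rewrite (_ : c y - c z - (c x - c z) = c y - c x) ?ler_norml; [case/andP|ring].
- have [zy|yz|->] := ltgtP z y.
  + rewrite opprK.
    (* If c z is not between c x and c y, one of the two terms is K3 0, which
       compensates the other one. *)
    have Ld : 0 <= L * `|c y - c x| by rewrite mulr_ge0.
    have := K3_norm_le (m0 (c y - c z)); have := K3_norm_le (m0 (- (c x - c z))).
    have := Klb (c y - c z); have := Klb (- (c x - c z)).
    rewrite !(ler_norml (K3 _)).
    case: (leP (c y - c z) 0) => p0; first by lra.
    case: (leP (- (c x - c z)) 0) => q0; first by lra.
    (* Now [c z] lies between [c x] and [c y], and the two lower bounds [Klb] add up to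
       [- (L * (c y - c x))]. *)
    have d0 : 0 < c y - c x by lra.
    by rewrite (gtr0_norm p0) (gtr0_norm q0) (gtr0_norm d0); lra.
  + have := KL (- (c x - c z)) (- (c y - c z)).
    rewrite (_ : - (c x - c z) - - (c y - c z) = c y - c x); last by ring.
    by rewrite ler_norml => /andP[]; lra.
  + by rewrite opprK add0r opprB; exact: Klb.
- by rewrite xy subr0; exact: Klb.
Qed.

End kernel.

(** * Integrals of bounded functions against a finite measure *)

Section bounded_integral.
Context d {T : measurableType d} {R : realType}.
Variable mu : {finite_measure set T -> \bar R}.
Implicit Types f g : T -> R.

Lemma finite_bounded_integrable f B : measurable_fun setT f ->
  (forall x, `|f x| <= B) -> mu.-integrable setT (EFin \o f).
Proof.
move=> mf fB; apply: measurable_bounded_integrable => //.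
  by rewrite -ge0_fin_numE// fin_num_measure.
exists B; split; first exact: num_real.
by move=> r Br x _; rewrite /= (le_trans (fB x))// ltW.
Qed.

Lemma Rintegral_bound f B : measurable_fun setT f ->
  (forall x, `|f x| <= B) -> `|\int[mu]_x f x| <= B * fine (mu setT).
Proof.
move=> mf fB; have fi := finite_bounded_integrable mf fB.
apply: (le_trans (le_normr_Rintegral measurableT fi)).
rewrite -Rintegral_cst//; apply: le_Rintegral => //.
- exact: integrable_norm.
- by apply: (@finite_bounded_integrable _ `|B|).
Qed.

(** One-sided, as the order estimate is; two-sided bounds come from applying it in both
    directions. *)
Lemma Rintegral_diff_ge f g B e : measurable_fun setT f -> measurable_fun setT g ->
  (forall x, `|f x| <= B) -> (forall x, `|g x| <= B) ->
  (forall x, - e <= f x - g x) ->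
  - (e * fine (mu setT)) <= \int[mu]_x f x - \int[mu]_x g x.
Proof.
move=> mf mg fB gB fg.
have fi := finite_bounded_integrable mf fB.
have gi := finite_bounded_integrable mg gB.
rewrite -RintegralB// -mulNr -Rintegral_cst//; apply: le_Rintegral => //.
- by apply: (@finite_bounded_integrable _ `|- e|).
- apply: (@finite_bounded_integrable _ (B + B)); first exact: measurable_funB.
  by move=> x; rewrite (le_trans (ler_normB _ _))// lerD.
Qed.

End bounded_integral.

Lemma measurable_parametric_Rintegral d1 d2 (X : measurableType d1)
    (Y : measurableType d2) (R : realType)
    (mu : {finite_measure set Y -> \bar R}) (f : X * Y -> R) (B : R) :
  measurable_fun setT f -> (forall p, `|f p| <= B) ->
  measurable_fun setT (fun x => \int[mu]_y f (x, y)).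
Proof.
move=> mf fB.
have mfx x : measurable_fun setT (fun y => f (x, y)).
  exact: measurableT_comp mf (pair1_measurable x).
(* The shift by B allows for the Tonelli measurability of nonnegative integrals. *)
have -> : (fun x => \int[mu]_y f (x, y)) = (fun x =>
    fine (\int[mu]_y (f (x, y) + B)%:E) - B * fine (mu setT)).
  apply/funext => x; rewrite -Rintegral_cst// -/(Rintegral mu setT _).
  rewrite RintegralD ?addrK//.
  + exact: finite_bounded_integrable (mfx x) (fun y => fB (x, y)).
  + by apply: (@finite_bounded_integrable _ _ _ _ _ `|B|).
apply: measurable_funB => //.
apply: measurableT_comp => //.
apply: (@measurable_fun_fubini_tonelli_F _ _ _ _ _ mu
  (fun p => (f p + B)%:E)).
- by apply/measurable_EFinP; exact: measurable_funD.
- by move=> p; rewrite lee_fin; have := fB p; rewrite ler_norml => /andP[]; lra.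
Qed.

(** In the splitting [(h - h') * (h + h') * a + h' ^+ 2 * (a - a')] the factor [h' ^+ 2] is
    nonnegative, so a lower bound on [a - a'] is enough. *)
Lemma sqrM_diff_ge (R : realFieldType) (h h' a a' b e : R) :
  `|h| <= b -> `|h'| <= b -> `|a| <= b -> `|h - h'| <= e -> - e <= a - a' ->
  - (3 * b ^+ 2 * e) <= h ^+ 2 * a - h' ^+ 2 * a'.
Proof.
move=> hb hb' ab hh aa.
have -> : h ^+ 2 * a - h' ^+ 2 * a' =
  (h - h') * (h + h') * a + h' ^+ 2 * (a - a') by ring.
have e0 : 0 <= e := le_trans (normr_ge0 _) hh.
have b0 : 0 <= b := le_trans (normr_ge0 _) hb.
have : `|(h - h') * (h + h') * a| <= e * (b + b) * b.
  rewrite !normrM; do 2 (apply: ler_pM => //).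
  by rewrite (le_trans (ler_normD _ _))// lerD.
rewrite ler_norml => /andP[+ _].
have h2 : h' ^+ 2 <= b ^+ 2 by rewrite -real_normK ?num_real// lerXn2r// nnegrE.
have := ler_wpM2l (sqr_ge0 h') aa; have := ler_wpM2r e0 h2.
lra.
Qed.

(** * From the Taylor estimate to differentiability in time *)

Section time_derivative.
Context {R : realType}.
Variables (f g : R -> R) (Q Q' : R).
Hypothesis fQ : forall s t, 0 <= s <= t ->
  `|f t - f s - (t - s) * g s| <= Q * (t - s) ^+ 2.
Hypothesis gQ : forall s t, 0 <= s <= t -> `|g t - g s| <= Q' * (t - s).

(** [fQ] expands about the earlier time only. For [s] before [t] the slope is moved from [s] to [t]
    by [gQ], at the cost of another quadratic term. *)
Let taylor s t : 0 <= s -> 0 <= t ->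
  `|f s - f t - (s - t) * g t| <= (`|Q| + `|Q'|) * (s - t) ^+ 2.
Proof.
move=> s0 t0; have [ts|/ltW st] := leP t s.
  rewrite (le_trans (fQ _))//; first by apply/andP.
  by rewrite ler_wpM2r ?sqr_ge0// (le_trans (ler_norm _))// lerDl.
have -> : f s - f t - (s - t) * g t =
  - (f t - f s - (t - s) * g s) + (t - s) * (g t - g s) by ring.
rewrite (le_trans (ler_normD _ _))// normrN normrM ger0_norm ?subr_ge0//.
have st' : 0 <= s <= t by apply/andP.
have ts0 : 0 <= t - s by rewrite subr_ge0.
have := ler_wpM2l ts0 (gQ st'); have := fQ st'.
have := ler_wpM2r (sqr_ge0 (t - s)) (ler_norm Q).
have := ler_wpM2r (sqr_ge0 (t - s)) (ler_norm Q').
nra.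
Qed.

Let quotient s t : 0 <= s -> 0 <= t -> s != t ->
  `|g t - (f s - f t) / (s - t)| <= (`|Q| + `|Q'|) * `|s - t|.
Proof.
move=> s0 t0 st; have st0 : s - t != 0 by rewrite subr_eq0.
rewrite distrC -(ler_pM2r (x := `|s - t|)) ?normr_gt0// -normrM.
rewrite mulrBl divfK// (mulrC (g t)).
have := taylor s0 t0; rewrite -real_normK ?num_real//; nra.
Qed.

Let lipschitz s t : 0 <= s -> 0 <= t -> `|g t - g s| <= `|Q'| * `|t - s|.
Proof.
wlog st : s t / s <= t => [wl|] s0 t0.
  have [/wl|/ltW/wl] := leP s t; first exact.
  by rewrite distrC (distrC t); exact.
rewrite (le_trans (gQ _)) ?s0// (@ger0_norm _ (t - s)) ?subr_ge0//.
by rewrite ler_wpM2r ?subr_ge0// ler_norm.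
Qed.

Let small e : 0 < e -> {e' | 0 < e' & forall r : R, `|r| <= e' ->
  (`|Q| + `|Q'|) * `|r| <= e}.
Proof.
(* The summand 1 keeps the denominator positive when [Q] and [Q'] vanish. *)
have Q0 : 0 < `|Q| + `|Q'| + 1 by rewrite ltr_pwDr// addr_ge0.
move=> e0; exists (e / (`|Q| + `|Q'| + 1)); first by rewrite divr_gt0.
by move=> r; rewrite ler_pdivlMr//; have := normr_ge0 r; nra.
Qed.

Let near_le (t e : R) : 0 < e -> \forall s \near t, `|t - s| <= e.
Proof. by move=> e0; exact: cvgr_dist_le (@cvg_id _ (nbhs t)) _ e0. Qed.

Lemma taylor_C1_nonneg : C1_nonneg f.
Proof.
exists g.
  apply/subspace_continuousP => t; rewrite /= in_itv/= andbT => t0.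
  apply/cvgrPdist_le => e /small[e' e'0 ee']; rewrite near_withinE.
  apply: filterS (near_le t e'0) => s ts; rewrite /= in_itv/= andbT => s0.
  rewrite (le_trans (lipschitz s0 t0))// (le_trans _ (ee' _ ts))//.
  by rewrite ler_wpM2r// lerDr.
move=> t t0; apply/cvgrPdist_le => e /small[e' e'0 ee'].
rewrite near_withinE /dnbhs near_withinE.
apply: filterS (near_le t e'0) => s ts /= st; rewrite in_itv/= andbT => s0.
by rewrite (le_trans (quotient s0 t0 st))// ee'// distrC.
Qed.

Lemma taylor_derive1 t : 0 < t -> derive1 f t = g t.
Proof.
move=> t0; rewrite /derive1; apply/cvg_lim => //.
apply/cvgrPdist_le => e /small[e' e'0 ee']; rewrite /dnbhs near_withinE.
(* An increment of size at most [t] keeps [h + t] nonnegative, where [quotient] applies. *)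
have m0 : 0 < Num.min e' t by rewrite lt_min e'0.
apply: filterS (near_le 0 m0) => h; rewrite sub0r normrN le_min => /andP[he ht] /= h0.
have ht0 : 0 <= h + t by move: ht; rewrite ler_norml => /andP[]; lra.
have htt : h + t != t by rewrite -subr_eq0 addrK.
have := quotient ht0 (ltW t0) htt; rewrite addrK /GRing.scale/= mulrC.
by move=> /le_trans; apply; rewrite ee'.
Qed.

End time_derivative.

(** * The velocity field on Borel functions *)

Section velocity.
Context {R : realType}.
Variable alpha : R.
Hypothesis alpha0 : 0 < alpha.
Variable mu : {finite_measure set (measurableTypeR R) -> \bar R}.

(** No point is removed from the second integral, since [ordered_K3] vanishes at [z = x]. *)
Definition velocity (c : R -> R) (x : R) : R :=
  (\int[mu]_z K alpha (c x - c z)) ^+ 2 *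
  \int[mu]_z ordered_K3 alpha x z (c x - c z).

Definition borel_fun (c : R -> R) :=
  measurable_fun setT (c : measurableTypeR R -> measurableTypeR R).

Lemma measurable_K d (T : measurableType d) (f : T -> R) :
  measurable_fun setT f -> measurable_fun setT (fun x => K alpha (f x)).
Proof.
move=> mf; rewrite /K.
have mn : measurable_fun setT (fun x => `|f x|) by exact: measurableT_comp.
apply: measurable_funM.
  by apply: measurable_funM => //; exact: measurable_funD.
apply: measurableT_comp => //.
by apply: measurable_funM => //; exact: measurableT_comp.
Qed.

Lemma measurable_ordered_K3 d (T : measurableType d) (X Z W : T -> R) :
  measurable_fun setT X -> measurable_fun setT Z -> measurable_fun setT W ->
  measurable_fun setT (fun p => ordered_K3 alpha (X p) (Z p) (W p)).
Proof.
move=> mX mZ mW; rewrite /ordered_K3.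
have mK3 (V : T -> R) : measurable_fun setT V ->
    measurable_fun setT (fun p => K3 alpha (Num.max (V p) 0)).
  move=> mV; have mV0 : measurable_fun setT (fun p => Num.max (V p) 0).
    exact: measurable_maxr.
  rewrite /K3 /affine_exp; apply: measurable_funM.
    by apply: measurable_funD => //; exact: measurable_funM.
  apply: measurableT_comp => //.
  by apply: measurable_funM => //; exact: measurableT_comp.
apply: measurable_fun_ifT; [exact: measurable_fun_ltr|exact: mK3|].
apply: measurable_fun_ifT => //; first exact: measurable_fun_ltr.
by apply: measurableT_comp => //; apply: mK3; exact: measurableT_comp.
Qed.

Lemma measurable_K_diff c x : borel_fun c ->
  measurable_fun setT (fun z : measurableTypeR R => K alpha (c x - c z)).
Proof. by move=> mc; apply: measurable_K; exact: measurable_funB. Qed.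

Lemma measurable_ordered_K3_diff c x : borel_fun c ->
  measurable_fun setT
    (fun z : measurableTypeR R => ordered_K3 alpha x z (c x - c z)).
Proof.
by move=> mc; apply: measurable_ordered_K3 => //; exact: measurable_funB.
Qed.

Lemma measurable_velocity c : borel_fun c -> borel_fun (velocity c).
Proof.
move=> mc; have [B _ KB] := K_bound alpha0.
have md : measurable_fun setT
    (fun p : measurableTypeR R * measurableTypeR R => c p.1 - c p.2).
  by apply: measurable_funB; exact: measurableT_comp.
apply: measurable_funM; first apply: measurable_funX.
  apply: (@measurable_parametric_Rintegral _ _ _ _ _ mu
    (fun p : measurableTypeR R * measurableTypeR R => K alpha (c p.1 - c p.2)) B).
    exact: measurable_K.
  by move=> p; exact: KB.
apply: (@measurable_parametric_Rintegral _ _ _ _ _ mu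
  (fun p : measurableTypeR R * measurableTypeR R =>
     ordered_K3 alpha p.1 p.2 (c p.1 - c p.2)) (K3 alpha 0)).
  exact: measurable_ordered_K3.
by move=> p; exact: ordered_K3_bound.
Qed.

(** Supplies the bound, the Lipschitz and the order hypotheses of [euler_flow], one constant [C]
    serving for the last two. *)
Lemma velocity_bounds : exists b C : R, [/\ 0 <= b, 0 <= C,
  forall c x, borel_fun c -> `|velocity c x| <= b,
  forall c d e, borel_fun c -> borel_fun d ->
    (forall x, `|c x - d x| <= e) ->
    forall x, `|velocity c x - velocity d x| <= C * e &
  forall c x y, borel_fun c -> x < y ->
    - (C * `|c y - c x|) <= velocity c y - velocity c x].
Proof.
have [B B0 KB] := K_bound alpha0; have [L L0 KL] := K_lipschitz alpha0.
have [L' [L'0 OL Oorder]] := ordered_K3_lipschitz alpha0.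
pose m := fine (mu setT); have m0 : 0 <= m by exact: fine_ge0.
pose O0 := K3 alpha 0.
have OB := ordered_K3_bound alpha0.
have O00 : 0 <= O0 by rewrite (le_trans (normr_ge0 _) (OB 0 0 0)).
pose b := (B + O0) * m; have b0 : 0 <= b by rewrite mulr_ge0// addr_ge0.
pose A (c : R -> R) x := \int[mu]_z ordered_K3 alpha x z (c x - c z).
pose H0 (c : R -> R) x := \int[mu]_z K alpha (c x - c z).
have Hb c x : borel_fun c -> `|H0 c x| <= b.
  move=> mc; rewrite (le_trans (Rintegral_bound mu (measurable_K_diff x mc) (fun z => KB _)))//.
  by rewrite ler_wpM2r// lerDl.
have Ab c x : borel_fun c -> `|A c x| <= b.
  move=> mc.
  rewrite (le_trans (Rintegral_bound mu (measurable_ordered_K3_diff x mc) (fun z => OB _ _ _)))//.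
  by rewrite ler_wpM2r// lerDr.
(* Used with two functions at one point for the Lipschitz bound, and with one function at two points
   for the order estimate. *)
have Hdiff c d x y e : borel_fun c -> borel_fun d ->
    (forall z, `|(c x - c z) - (d y - d z)| <= e) ->
    `|H0 c x - H0 d y| <= L * e * m.
  move=> mc md cd; rewrite ler_norml; apply/andP; split.
    apply: (@Rintegral_diff_ge _ _ _ mu _ _ B (L * e)) => //; try exact: measurable_K_diff.
    move=> z; have := le_trans (KL _ _) (ler_wpM2l L0 (cd z)).
    by rewrite ler_norml => /andP[].
  rewrite -[X in _ <= X]opprK lerNr opprB.
  apply: (@Rintegral_diff_ge _ _ _ mu _ _ B (L * e)) => //; try exact: measurable_K_diff.
  move=> z; have := le_trans (KL _ _) (ler_wpM2l L0 (cd z)).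
  by rewrite distrC ler_norml => /andP[].
(* If [c] moves by [e], then [c x - c z] moves by at most [2 * e], whence the factors 2. The
   contributions of [K] and [ordered_K3] are added to give the single error of [sqrM_diff_ge]. *)
pose C := 3 * b ^+ 2 * ((2 * L + 2 * L') * m).
have C0 : 0 <= C by rewrite /C !mulr_ge0// ?exprn_ge0// addr_ge0// mulr_ge0.
have lip1 c d e x : borel_fun c -> borel_fun d ->
    (forall x, `|c x - d x| <= e) -> - (C * e) <= velocity c x - velocity d x.
  move=> mc md cd; have e0 := le_trans (normr_ge0 _) (cd x).
  have cd2 z : `|(c x - c z) - (d x - d z)| <= 2 * e.
    rewrite (_ : _ - _ = (c x - d x) - (c z - d z)); last by ring.
    by rewrite (le_trans (ler_normB _ _))//; have := cd x; have := cd z; lra.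
  rewrite (_ : C * e = 3 * b ^+ 2 * ((2 * L + 2 * L') * m * e)); last first.
    by rewrite /C; ring.
  apply: sqrM_diff_ge; [exact: (Hb c x mc)|exact: (Hb d x md)|exact: (Ab c x mc)|..].
    rewrite (le_trans (Hdiff _ _ _ _ _ mc md cd2))//.
    have := mulr_ge0 (mulr_ge0 L'0 m0) e0; lra.
  apply: (@le_trans _ _ (- (L' * (2 * e) * m))).
    by have := mulr_ge0 (mulr_ge0 L0 m0) e0; lra.
  apply: (@Rintegral_diff_ge _ _ _ mu _ _ O0 (L' * (2 * e))) => //;
    try exact: measurable_ordered_K3_diff.
  move=> z; have := le_trans (OL x z _ _) (ler_wpM2l L'0 (cd2 z)).
  by rewrite ler_norml => /andP[].
exists (b ^+ 2 * b), C; split => //.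
- by rewrite mulr_ge0// exprn_ge0.
- move=> c x mc; rewrite /velocity normrM normrX ler_pM// ?exprn_ge0//.
    by rewrite lerXn2r ?nnegrE//; exact: (Hb c x mc).
  exact: (Ab c x mc).
- move=> c d e mc md cd x; rewrite ler_norml lip1//= -[X in _ <= X]opprK lerNr opprB.
  by rewrite lip1// => y; rewrite distrC.
- move=> c x y mc xy; have e0 : 0 <= `|c y - c x| by rewrite normr_ge0.
  set e := `|c y - c x| in e0 *.
  rewrite (_ : C * e = 3 * b ^+ 2 * ((2 * L + 2 * L') * m * e)); last first.
    by rewrite /C; ring.
  apply: sqrM_diff_ge; [exact: (Hb c y mc)|exact: (Hb c x mc)|exact: (Ab c y mc)|..].
    have cc z : `|(c y - c z) - (c x - c z)| <= e.
      by rewrite /e (_ : _ - _ = c y - c x)//; ring.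
    rewrite (le_trans (Hdiff _ _ _ _ _ mc mc cc))//.
    have := mulr_ge0 (mulr_ge0 L'0 m0) e0.
    have := mulr_ge0 (mulr_ge0 L0 m0) e0; lra.
  apply: (@le_trans _ _ (- (L' * e * m))).
    have := mulr_ge0 (mulr_ge0 L'0 m0) e0.
    by have := mulr_ge0 (mulr_ge0 L0 m0) e0; lra.
  apply: (@Rintegral_diff_ge _ _ _ mu _ _ O0 (L' * e)) => //;
    try exact: measurable_ordered_K3_diff.
  by move=> z; exact: Oorder.
Qed.

(** [c x - c z] has the sign of [x - z], so the truncations by [Num.max] are inactive. *)
Lemma velocity_increasing (c : R -> R) x : {homo c : x y / x < y} ->
  velocity c x = (\int[mu]_z K alpha (c x - c z)) ^+ 2 *
    \int[mu]_(z in [set z | z <> x]) K''' alpha (c x - c z).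
Proof.
move=> c_incr; rewrite /velocity; congr (_ * _).
rewrite [RHS]Rintegral_mkcond; apply: eq_Rintegral => z _.
rewrite /patch /ordered_K3; have [zx|xz|->] := ltgtP z x.
- rewrite mem_set/=; last by move=> /eqP; rewrite lt_eqF.
  have d0 : 0 < c x - c z by rewrite subr_gt0 c_incr.
  by rewrite K'''_gt0// max_l// ltW.
- rewrite mem_set/=; last by move=> /eqP; rewrite gt_eqF.
  have d0 : c x - c z < 0 by rewrite subr_lt0 c_incr.
  by rewrite K'''_lt0// max_l// oppr_ge0 ltW.
- by rewrite memNset//=; exact.
Qed.

End velocity.

(** * The solution starting from the identity *)

Unset Implicit Arguments.

Theorem theorem4p5 (R : realType) (alpha : R) (alpha_gt0 : 0 < alpha)
    (mu : {finite_measure set (measurableTypeR R) -> \bar R})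
    (mu_neq0 : ~ zero_measure mu)
    (mu_le1 : (total_variation_norm mu <= 1)%E) :
  exists c : R -> R -> R,
    [/\ in_I c,
        forall x t : R, 0 < t ->
          derive1 (c x) t =
            H alpha mu c x t ^+ 2 *
            \int[mu]_(z in [set z | z <> x]) K''' alpha (c x t - c z t) &
        forall x : R, c x 0 = x].
Proof.
have [b [C [b0 C0 vb vlip vorder]]] := velocity_bounds alpha_gt0 mu.
have [|h c mc|u c mu_ uc|//|//|//|//|c [c0 mc cM cT c_incr]] :=
  @euler_flow R R (velocity alpha mu) (@borel_fun R) id b C.
- exact: measurable_id.
- by apply: measurable_funD => //; apply: measurable_funM => //; exact: measurable_velocity.
- by apply: measurable_fun_cvg => [n|x _]; [exact: (mu_ n)|exact: uc].
(* [b] bounds the speed of the flow and [C] is the Lipschitz constant of the velocity. *)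
have taylor x s t : 0 <= s <= t ->
  `|velocity alpha mu (c ^~ t) x - velocity alpha mu (c ^~ s) x| <= C * b * (t - s).
  move=> st; have /andP[s0 st'] := st; rewrite -mulrA.
  by apply: vlip => [||y]; [apply: mc; exact: le_trans st'|exact: mc|exact: cM].
exists c; split => [|x t t0|//].
- split.
  (* On the unit ball about [(x, t)], [y] is within 1 of [x] and [c y s] within [b * (t + 1)] of
     [y]. *)
  + move=> [x t] _; exists (`|x| + 1 + b * (t + 1)); split; first exact: num_real.
    move=> r Br; rewrite /within/=.
    apply: filterS (nbhsx_ballx (x, t) 1 ltr01) => -[y s] /= [].
    rewrite /ball/= => xy ts s0; rewrite (le_trans _ (ltW Br))//.
    have := cM y 0 s; rewrite lexx s0 c0 => /(_ isT) cs.
    rewrite -[c y s](subrK y) (le_trans (ler_normD _ _))// addrC lerD//.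
      rewrite -[y](subrK x) (le_trans (ler_normD _ _))// addrC lerD//.
      by rewrite distrC ltW.
    rewrite (le_trans cs)// ler_wpM2l//.
    by move: ts; rewrite ltr_norml => /andP[]; lra.
  + exact: mc.
  + by move=> x; exact: taylor_C1_nonneg (cT x) (taylor x).
  + move=> t x y t0 xy; apply: (c_incr x y C) => // d md; exact: vorder.
- rewrite (taylor_derive1 (cT x) (taylor x))// velocity_increasing//.
  by move=> y z yz; apply: (c_incr y z C) => // [d md|]; [exact: vorder|exact: ltW].
Qed.
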